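(* Let $B$ be a Ferrers board with row lengths given by the integer partition $b=(b_1,b_2,\ldots)$ and column lengths given by the conjugate partition $b'=(b_1',b_2',\ldots)$. Let $N=\sum_i b_i$, $L=\sum_i\binom{b_i}{2}$, $L'=\sum_i\binom{b_i'}{2}$. Assume $N\ge3$ and let $k$ be an integer with $2\le k\le N$. Define $$\lambda:=\frac{\binom k2 L}{\binom N2},\qquad \lambda':=\frac{\binom k2L'}{\binom N2},$$ $$s_0:=\frac{L}{\binom N2},\quad s_0':=\frac{L'}{\binom N2},\quad s_1:=\frac{2(k-2)L}{\binom N2},\quad s_1':=\frac{2(k-2)L'}{\binom N2},$$ $$s_2:=(k-2)\sum_i\binom{b_i}{2}\frac{b_i-2}{N-2},\qquad s_2':=(k-2)\sum_i\binom{b_i'}{2}\frac{b_i'-2}{N-2},$$ $$s_3:=(k-2)\sum_i\sum_{c_1=1}^{b_i-1}\sum_{c_2=c_1+1}^{b_i}\left[\frac{b_{c_1}'-1}{N-2}+\frac{b_{c_2}'-1}{N-2}\right],$$ $$s_3':=(k-2)\sum_i\sum_{c_1=1}^{b_i'-1}\sum_{c_2=c_1+1}^{b_i'}\left[\frac{b_{c_1}-1}{N-2}+\frac{b_{c_2}-1}{N-2}\right],$$ $$s_4:=\frac{13-12k+3k^2}{\binom N2},$$ $$d_3:=s_0+s_0'+s_1+s_1'+\frac{s_2+s_2'+s_3+s_3'}{L+L'}+s_4,\qquad R_{n,k}:=\min\left(d_3,\ (\lambda+\lambda')d_3,\ 1\right).$$ Then $$\binom Nk e^{-(\lambda+\lambda')}\left(1-e^{\lambda+\lambda'}R_{n,k}\right)\le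 r_B(k)\le\binom Nk e^{-(\lambda+\lambda')}\left(1+e^{\lambda+\lambda'}R_{n,k}\right).$$ Moreover, if $L'>0$ and $$d_4:=s_0'+s_1'+\frac{s_2'+s_3'}{L'}+s_4,\qquad F_{n,k}:=\min\left(d_4,\ \lambda'd_4,\ 1\right),$$ then $$\binom Nk e^{-\lambda'}\left(1-e^{\lambda'}F_{n,k}\right)\le f_B(k)\le\binom Nk e^{-\lambda'}\left(1+e^{\lambda'}F_{n,k}\right).$$
   Context: A Ferrers board $B$ with row lengths $b_1\ge b_2\ge\cdots\ge b_\ell\ge1$ (integers) is the set of squares $\{(i,j):1\le i\le\ell,\ 1\le j\le b_i\}$, where $i$ is the row and $j$ the column; its column lengths are given by the conjugate partition $b_i'=\#\{j:b_j\ge i\}$. Sums over $i$ run over the nonzero parts of the relevant partition. The rook number $r_B(k)$ is the number of ways to place $k$ (indistinguishable) rooks on distinct squares of $B$ with no two in the same row or the same column. The file number $f_B(k)$ is the number of ways to place $k$ (indistinguishable) rooks on distinct squares of $B$ with no two in the same column. The subscript $n$ in $R_{n,k}$ and $F_{n,k}$ is only notation; these quantities depend on $B$ and $k$. *)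

(* Defs.v *)
From mathcomp Require Import all_boot all_order all_algebra.
From mathcomp Require Import reals.

Set Implicit Arguments.
Unset Strict Implicit.
Unset Printing Implicit Defensive.

Import Order.TTheory GRing.Theory Num.Theory.

Definition is_partition (b : seq nat) : bool :=
  sorted geq b && all (leq 1) b.

(* Parts are numbered from 1: for i >= 1, [part b i] is b_i, which is 0 beyond the last one. *)
Definition part (b : seq nat) (i : nat) : nat := nth 0 b i.-1.

(* b'_i = #{j : b_j >= i} for 1 <= i <= b_1, i.e. exactly the nonzero parts
   of the conjugate when [b] is a partition. *)
Definition conj_part (b : seq nat) : seq nat :=
  [seq count (leq i) b | i <- iota 1 (part b 1)].

(* For a partition, every square lies in the l x b_1 rectangle, where l is the
   number of rows.  The square (i, j) of the board is represented by the pair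
   of ordinals (i - 1, j - 1). *)
Definition square (b : seq nat) : finType := ('I_(size b) * 'I_(part b 1))%type.

Definition board (b : seq nat) : {set square b} :=
  [set s : square b | s.2.+1 <= part b s.1.+1].

Definition distinct_rows (b : seq nat) (P : {set square b}) : bool :=
  [forall s in P, forall t in P, (s != t) ==> (s.1 != t.1)].

Definition distinct_columns (b : seq nat) (P : {set square b}) : bool :=
  [forall s in P, forall t in P, (s != t) ==> (s.2 != t.2)].

Definition rook_number (b : seq nat) (k : nat) : nat :=
  #|[set P : {set square b} | [&& P \subset board b, #|P| == k,
                                  distinct_rows P & distinct_columns P]]|.

Definition file_number (b : seq nat) (k : nat) : nat :=
  #|[set P : {set square b} | [&& P \subset board b, #|P| == k
                                & distinct_columns P]]|.

(* L for p = b, and L' for p = b'. *)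
Definition pair_count (p : seq nat) : nat := \sum_(r <- p) 'C(r, 2).

Local Open Scope ring_scope.

(* In what follows N is the number of squares of the board, p is one of the
   partitions b, b' and (in [s3]) q is the other one; the primed quantities are
   obtained by exchanging b and b'.  All subtractions are in R. *)
Definition lam (R : realType) (N k : nat) (p : seq nat) : R :=
  'C(k, 2)%:R * (pair_count p)%:R / 'C(N, 2)%:R.

Definition s0 (R : realType) (N : nat) (p : seq nat) : R :=
  (pair_count p)%:R / 'C(N, 2)%:R.

Definition s1 (R : realType) (N k : nat) (p : seq nat) : R :=
  2 * (k%:R - 2) * (pair_count p)%:R / 'C(N, 2)%:R.

Definition s2 (R : realType) (N k : nat) (p : seq nat) : R :=
  (k%:R - 2) * \sum_(r <- p) ('C(r, 2)%:R * ((r%:R - 2) / (N%:R - 2))).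

Definition s3 (R : realType) (N k : nat) (p q : seq nat) : R :=
  (k%:R - 2) *
  \sum_(r <- p) \sum_(1 <= c1 < r) \sum_(c1.+1 <= c2 < r.+1)
    (((part q c1)%:R - 1) / (N%:R - 2) + ((part q c2)%:R - 1) / (N%:R - 2)).

Definition s4 (R : realType) (N k : nat) : R :=
  (13 - 12 * k%:R + 3 * k%:R ^+ 2) / 'C(N, 2)%:R.

(* Main.v *)
Require Import Defs.
From mathcomp Require Import all_boot all_order all_algebra.
From mathcomp Require Import reals sequences exp.
From mathcomp Require Import perm topology normedtype derive realfun.
From mathcomp Require Import zify ring lra.

(* Place the k rooks on a uniformly random k-subset P of the board and let W(P)
   be its number of attacking pairs, so that lambda = E W.  With
   phi(x) = \sum_P x^W(P), the function exp(- lambda x) phi(x) equals the rook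
   number at 0 and 'C(N, k) exp(- lambda) at 1, and its derivative is controlled
   by phi' - lambda phi on [0, 1].  The derivative phi' is a sum over attacking
   pairs (s, t) of sums over the P containing s and t.  To compare it with
   lambda phi, choose an ordered pair (i, j) in P and apply to P a permutation
   that moves i to s and j to t, yielding P'.  Then W(P') - 1 and W(P) can
   differ in one direction only if P' contains a third square attacking s or t
   (s_2 and s_3), in the other only if i or j attacks a square of P (s_0 and s_1)
   or if s and t were already in P \ {i, j} (s_4). *)

Set Implicit Arguments.
Unset Strict Implicit.
Unset Printing Implicit Defensive.

Import Order.TTheory GRing.Theory Num.Theory.
Import numFieldNormedType.Exports.
Local Open Scope ring_scope.

(** * Random subsets and the coupling *)

Section Draws.
Variables (T : finType).
Implicit Types (A B P : {set T}).

Definition draws B k : {set {set T}} := [set P : {set T} | P \subset B & #|P| == k].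

Definition pairs P : {set T * T} :=
  [set ij : T * T | [&& ij.1 \in P, ij.2 \in P & ij.1 != ij.2]].

Lemma card_pairs P : #|pairs P| = (#|P| * #|P|.-1)%N.
Proof.
have -> : pairs P = setX P P :\: [set (i, i) | i in P].
  apply/setP=> -[i j]; rewrite !inE /=.
  case: (i \in P) / boolP => iP; rewrite ?andbF //=.
  case: (j \in P) / boolP => jP; rewrite ?andbF //= andbT.
  congr negb; apply/eqP/imsetP => [->|[x xP [-> ->]] //]; by exists j.
rewrite cardsD (setIidPr _); last first.
  by apply/subsetP => _ /imsetP[i iP ->]; rewrite !inE iP.
by rewrite cardsX card_imset => [|i j []//]; case: #|P| => // n; rewrite mulnS addKn.
Qed.

(** Adding [A] is a bijection from the [(k - #|A|)]-subsets of [B :\: A] onto the sets counted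
    here. *)
Lemma card_drawsU B A k : A \subset B -> (#|A| <= k)%N ->
  #|[set P : {set T} in draws B k | A \subset P]| = 'C(#|B| - #|A|, k - #|A|).
Proof.
move=> AB Ak; rewrite -(cardsDS AB) -(cards_draws (B :\: A)).
have inj : {in [set P : {set T} | P \subset B :\: A & #|P| == (k - #|A|)%N] &, injective (setU A)}.
  move=> P Q; rewrite !inE !subsetD => /andP[/andP[_ PA] _] /andP[/andP[_ QA] _] eqU.
  have D (X : {set T}) : [disjoint X & A] -> X = (A :|: X) :\: A.
    rewrite -setI_eq0 setIC => /eqP XA.
    by rewrite setDUl setDv set0U setDE -{1}(setID X A) setIC XA set0U setDE.
  by rewrite (D P) // (D Q) // eqU.
rewrite -(card_in_imset inj); apply: eq_card => P; rewrite !inE.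
apply/idP/imsetP => [/andP[/andP[PB /eqP Pk] AP]|[Q]].
  exists (P :\: A); last first.
    by apply/setP => x; rewrite !inE; case: (boolP (x \in A)) => [/(subsetP AP)|].
  by rewrite inE setSD //= cardsDS // Pk.
rewrite inE => /andP[]; rewrite subsetD => /andP[QB QA] /eqP Qk ->.
rewrite subUset AB QB subsetUl andbT /= cardsU setIC (disjoint_setI0 QA) cards0 Qk subn0.
by rewrite subnKC.
Qed.

Lemma sum_pairs_draws (V : nmodType) B k (h : {set T} -> T * T -> V) :
  \sum_(ij in pairs B) \sum_(P in draws B k | ij \in pairs P) h P ij
  = \sum_(P in draws B k) \sum_(ij in pairs P) h P ij.
Proof.
rewrite (exchange_big_dep (mem (draws B k))) /=; last by move=> ij P _ /andP[].
apply: eq_bigr => P PB; apply: eq_bigl => ij; rewrite PB /= !inE.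
move: PB; rewrite inE => /andP[/subsetP PB _].
case: (ij.1 \in P) / boolP => [/PB ->|]; rewrite ?andbF //=.
by case: (ij.2 \in P) / boolP => [/PB ->|]; rewrite ?andbF ?andbb //=.
Qed.

(* Sends ij.1 to s and ij.2 to t, and moves nothing besides these four points. *)
Definition move2 (s t : T) (ij : T * T) : {perm T} :=
  (tperm ij.1 s * tperm (tperm ij.1 s ij.2) t)%g.

Section Move2.
Variables (s t : T) (ij : T * T).
Hypotheses (st : s != t) (ij12 : ij.1 != ij.2).

Lemma move2L : move2 s t ij ij.1 = s.
Proof.
rewrite /move2 permM tpermL tpermD //; last by rewrite eq_sym.
by rewrite -{2}(tpermL ij.1 s) (inj_eq perm_inj) eq_sym.
Qed.

Lemma move2R : move2 s t ij ij.2 = t.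
Proof. by rewrite /move2 permM tpermL. Qed.

Lemma move2_out y : y \notin [set ij.1; ij.2; s; t] -> move2 s t ij y = y.
Proof.
rewrite !inE !negb_or -!andbA => /and4P[yi yj ys yt].
rewrite /move2 permM (tpermD (z := y)) 1?eq_sym // tpermD 1?eq_sym //.
by case: tpermP => [_|_|_ _].
Qed.

(** A permutation that fixes every point outside a set maps the set to itself. *)
Lemma move2_in y :
  (move2 s t ij y \in [set ij.1; ij.2; s; t]) = (y \in [set ij.1; ij.2; s; t]).
Proof.
apply: perm_closed; apply/subsetP => z; rewrite inE; apply: contraR => /move2_out ->.
exact: eqxx.
Qed.

Lemma move2_sub B : ij \in pairs B -> (s, t) \in pairs B ->
  [set ij.1; ij.2; s; t] \subset B.
Proof.
rewrite !inE /= => /and3P[iB jB _] /and3P[sB tB _].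
by rewrite !subUset !sub1set iB jB sB.
Qed.

Lemma sub_move2 B P : ij \in pairs B -> (s, t) \in pairs B ->
  (move2 s t ij @: P \subset B) = (P \subset B).
Proof.
move=> ijB stB; have sub := move2_sub ijB stB; apply/subsetP/subsetP => PB y.
  move=> yP; case: (boolP (y \in [set ij.1; ij.2; s; t])) => [/(subsetP sub)//|y4].
  by rewrite -(move2_out y4) PB // imset_f.
move=> /imsetP[z zP ->]; case: (boolP (z \in [set ij.1; ij.2; s; t])) => z4.
  by apply: (subsetP sub); rewrite move2_in.
by rewrite move2_out // PB.
Qed.

(** The image can gain points only among the four special ones; apart from [s] and [t] these are
    [ij.1] and [ij.2], which [P] already contains. *)
Lemma move2_setD_sub P : ij \in pairs P ->
  move2 s t ij @: P :\: [set s; t] \subset P.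
Proof.
rewrite inE => /and3P[iP jP _]; apply/subsetP => y /setDP[/imsetP[z zP ->]].
case: (boolP (z \in [set ij.1; ij.2; s; t])) => z4; last by rewrite move2_out.
move: z4; rewrite -move2_in !inE -!orbA => /or4P[/eqP->|/eqP->|/eqP->|/eqP->] //.
all: by rewrite eqxx ?orbT.
Qed.

Lemma setD_sub_move2 P : ij \in pairs P ->
  P :\: [set ij.1; ij.2] \subset move2 s t ij @: P.
Proof.
rewrite inE => /and3P[iP jP _]; apply/subsetP => y; rewrite !inE negb_or.
move=> /andP[/andP[yi yj] yP].
have [->|ys] := eqVneq y s; first by apply/imsetP; exists ij.1; rewrite ?move2L.
have [->|yt] := eqVneq y t; first by apply/imsetP; exists ij.2; rewrite ?move2R.
apply/imsetP; exists y => //; rewrite move2_out // !inE !negb_or.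
by rewrite yi yj ys yt.
Qed.

Lemma mem_move2 P : ij \in pairs P -> (s \in move2 s t ij @: P) && (t \in move2 s t ij @: P).
Proof.
rewrite inE => /and3P[iP jP _].
by apply/andP; split; apply/imsetP; [exists ij.1|exists ij.2]; rewrite ?move2L ?move2R.
Qed.

End Move2.

(* For fixed ij, P |-> move2 s t ij @: P is a bijection from the k-sets
   containing ij to those containing s and t. *)
Lemma sum_move2 (V : nmodType) B k (s t : T) (h : {set T} -> V) :
  (s, t) \in pairs B ->
  \sum_(ij in pairs B) \sum_(P in draws B k | ij \in pairs P) h (move2 s t ij @: P)
  = (\sum_(P in draws B k | (s, t) \in pairs P) h P) *+ #|pairs B|.
Proof.
move=> stB; rewrite -sumr_const; apply: eq_bigr => ij ijB.
have st : s != t by move: stB; rewrite inE => /and3P[].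
have ij12 : ij.1 != ij.2 by move: ijB; rewrite inE => /and3P[].
rewrite [RHS](reindex_inj (imset_inj (@perm_inj _ (move2 s t ij)))) /=.
apply: eq_bigl => P; rewrite !inE sub_move2 // (card_imset _ perm_inj) /= st ij12.
have mem y : (move2 s t ij y \in move2 s t ij @: P) = (y \in P).
  by rewrite mem_imset //; exact: perm_inj.
by rewrite -(mem ij.1) -(mem ij.2) move2L // move2R.
Qed.

End Draws.

(** * Edges inside a random subset *)

Section Graph.
Variables (R : realDomainType) (T : finType) (e : rel T).
Hypothesis e_asym : forall s t, e s t -> ~~ e t s.
Implicit Types (A B P : {set T}) (st : T * T).

(* [e] orients the graph, so that every edge is counted once. *)
Definition edges P : {set T * T} := [set st in pairs P | e st.1 st.2].

Definition edge_nbrs B st : {set T} :=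
  [set u in B :\: [set st.1; st.2] |
    [|| e u st.1, e st.1 u, e u st.2 | e st.2 u]].

Lemma e_neq s t : e s t -> s != t.
Proof. by move=> est; apply: contraTneq est => ->; apply/negP => /[dup] /e_asym /negP. Qed.

Lemma mem_edges P s t : ((s, t) \in edges P) = [&& s \in P, t \in P & e s t].
Proof.
rewrite !inE /=; case: (s \in P); case: (t \in P); rewrite //= andbC.
by case est : (e s t) => //=; rewrite e_neq.
Qed.

Lemma edgesS A B : A \subset B -> edges A \subset edges B.
Proof.
move=> /subsetP AB; apply/subsetP => -[s t]; rewrite !mem_edges.
by move=> /and3P[/AB -> /AB -> ->].
Qed.

(** When no third point of [P] is adjacent to [s] or [t], the only edge meeting [{s, t}] is [(s, t)]
    itself, asymmetry excluding [(t, s)]; all others survive the deletion. *)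
Lemma card_edges_isolated B P s t : P \subset B -> (s, t) \in edges P ->
  P :&: edge_nbrs B (s, t) = set0 ->
  (#|edges P| <= #|edges (P :\: [set s; t])|.+1)%N.
Proof.
move=> PB; rewrite mem_edges => /and3P[sP tP est] P0.
have free u : u \in P -> u != s -> u != t -> [|| e u s, e s u, e u t | e t u] = false.
  move=> uP us ut; apply: contra_eqF P0 => adj; apply/set0Pn; exists u.
  by rewrite !inE uP (negPf us) (negPf ut) (subsetP PB) //= adj.
apply: (@leq_trans #|(s, t) |: edges (P :\: [set s; t])|); last first.
  by rewrite cardsU1; case: (_ \notin _).
apply/subset_leq_card/subsetP => -[a c]; rewrite in_setU1 !mem_edges !inE.
move=> /and3P[aP cP eac].
have [as_|as_] := eqVneq a s.
  subst a; have [->|ct] := eqVneq c t; first by rewrite eqxx.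
  have cs : c != s by rewrite eq_sym e_neq.
  by have := free c cP cs ct; rewrite eac orbT.
have [at_|at_] := eqVneq a t.
  subst a; have ct : c != t by rewrite eq_sym e_neq.
  have cs : c != s by apply: contraTneq eac => ->; apply: e_asym.
  by have := free c cP cs ct; rewrite eac !orbT.
have /negbT := free a aP as_ at_; rewrite !negb_or => /and4P[eas _ eat _].
have [cs|cs] := eqVneq c s; first by rewrite cs (negPf eas) in eac.
have [ct|ct] := eqVneq c t; first by rewrite ct (negPf eat) in eac.
by rewrite aP cP eac /= orbT.
Qed.

Lemma card_edges_new P Q s t : (s, t) \in edges Q -> P \subset Q ->
  ~~ ((s \in P) && (t \in P)) -> (#|edges P| < #|edges Q|)%N.
Proof.
move=> stQ PQ nst; apply/proper_card/properP; split; first exact: edgesS.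
exists (s, t) => //; rewrite mem_edges.
by apply: contra nst => /and3P[-> ->].
Qed.

(** For [ij] in [pairs P] these are the edges with an end at [ij.1] or [ij.2]. The form by
    complement makes the number of [ij] touching a given edge a difference of two values of
    [card_pairs]. *)
Definition touching P (ij : T * T) : {set T * T} :=
  [set ac in edges P | ij \notin pairs (P :\: [set ac.1; ac.2])].

Lemma card_edges_untouched P ij : ij \in pairs P -> touching P ij = set0 ->
  edges P \subset edges (P :\: [set ij.1; ij.2]).
Proof.
move=> ijP P0; apply/subsetP => -[a c] acP.
have : (a, c) \notin touching P ij by rewrite P0 inE.
rewrite inE acP /= negbK; move: acP; rewrite !mem_edges !inE /=.
move=> /and3P[-> -> ->] /and3P[].
rewrite !negb_or => /andP[/andP[ia ic] _] /andP[/andP[ja jc] _] _.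
by rewrite [a == _]eq_sym ia [a == _]eq_sym ja [c == _]eq_sym ic [c == _]eq_sym jc.
Qed.

Section Powers.
Variable x : R.
Hypotheses (x0 : 0 <= x) (x1 : x <= 1).

Lemma exprB_le1 m n : x ^+ m - x ^+ n <= 1.
Proof. by rewrite lerBlDr (le_trans (exprn_ile1 _ _ _)) // lerDl exprn_ge0. Qed.

(** Powers of [x] lie in [0, 1], so a positive [c] is always enough; only [c = 0] requires comparing
    the exponents. The next two lemmas therefore only study the case of a zero error count. *)
Lemma exprB_le (m n c : nat) : (c = 0 -> n <= m)%N -> x ^+ m - x ^+ n <= c%:R.
Proof.
case: c => [/(_ erefl) nm|c _].
  by rewrite subr_le0 ler_wiXn2l.
by rewrite (le_trans (exprB_le1 _ _)) // ler1n.
Qed.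

(** If the error count is 0, every edge of [P] avoids [ij] and so survives in the image, which has
    the further edge [(s, t)]. Hence the image has strictly more edges than [P]. *)
Lemma removal_bound B P s t ij : (s, t) \in edges B -> P \subset B -> ij \in pairs P ->
  x ^+ #|edges (move2 s t ij @: P)|.-1 - x ^+ #|edges P|
  <= (((s, t) \in pairs (P :\: [set ij.1; ij.2])) + #|touching P ij|)%:R.
Proof.
rewrite mem_edges => /and3P[sB tB est] PB ijP; have st := e_neq est.
have [iP jP ij12] : [/\ ij.1 \in P, ij.2 \in P & ij.1 != ij.2].
  by apply/and3P; rewrite inE in ijP.
apply: exprB_le => /eqP; rewrite addn_eq0 eqb0 cards_eq0 => /andP[nst /eqP t0].
have new : (s, t) \in edges (move2 s t ij @: P).
  by rewrite mem_edges est andbT mem_move2.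
have lt : (#|edges P| < #|edges (move2 s t ij @: P)|)%N.
  apply: leq_ltn_trans (subset_leq_card (card_edges_untouched ijP t0)) _.
  apply: card_edges_new new (setD_sub_move2 st ij12 ijP) _.
  by move: nst; rewrite inE /= st andbT.
by rewrite -ltnS (ltn_predK lt).
Qed.

(** If the image has no neighbour of [s] or [t], deleting these two points costs it at most one
    edge, and what remains is contained in [P]. *)
Lemma creation_bound B P s t ij : (s, t) \in edges B -> P \subset B -> ij \in pairs P ->
  x ^+ #|edges P| - x ^+ #|edges (move2 s t ij @: P)|.-1
  <= #|move2 s t ij @: P :&: edge_nbrs B (s, t)|%:R.
Proof.
rewrite mem_edges => /and3P[sB tB est] PB ijP; have st := e_neq est.
have [iP jP ij12] : [/\ ij.1 \in P, ij.2 \in P & ij.1 != ij.2].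
  by apply/and3P; rewrite inE in ijP.
apply: exprB_le => /eqP; rewrite cards_eq0 => /eqP n0.
have new : (s, t) \in edges (move2 s t ij @: P).
  by rewrite mem_edges est andbT mem_move2.
have P'B : move2 s t ij @: P \subset B.
  rewrite sub_move2 //; last by rewrite inE /= sB tB.
  by rewrite inE ij12 !(subsetP PB).
rewrite -subn1 leq_subLR add1n (leq_trans (card_edges_isolated P'B new n0)) // ltnS.
exact: subset_leq_card (edgesS (move2_setD_sub s t ijP)).
Qed.

End Powers.

Lemma edges_setI B P : P \subset B -> edges P = edges B :&: pairs P.
Proof.
move=> /subsetP PB; apply/setP => -[s t]; rewrite !inE /=.
case: (s \in P) / boolP => sP; case: (t \in P) / boolP => tP; rewrite ?andbF //=.
by rewrite !PB //=; case: (s == t); rewrite ?andbF ?andbT.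
Qed.

Lemma sum_edges_draws (V : nmodType) B k (h : {set T} -> T * T -> V) :
  \sum_(P in draws B k) \sum_(st in edges P) h P st
  = \sum_(st in edges B) \sum_(P in draws B k | st \in pairs P) h P st.
Proof.
rewrite [RHS](exchange_big_dep (mem (draws B k))) /=; last by move=> st P _ /andP[].
apply: eq_bigr => P PB; apply: eq_bigl => st; rewrite PB /=.
by rewrite (@edges_setI B) 1?inE //; move: PB; rewrite inE => /andP[].
Qed.

Lemma card_draws_pair B k st : (1 < k)%N -> st \in pairs B ->
  #|[set P in draws B k | st \in pairs P]| = 'C(#|B| - 2, k - 2).
Proof.
rewrite inE => k1 /and3P[sB tB st12].
have c2 : #|[set st.1; st.2]| = 2%N by rewrite cards2 st12.
rewrite -c2 -card_drawsU ?c2 //; last by rewrite subUset !sub1set sB.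
apply: eq_card => P; rewrite !inE st12 subUset !sub1set andbT //.
Qed.

(** Double counting: an edge is touched by all [k (k - 1)] ordered pairs of [P] except the
    [(k - 2) (k - 3)] ones that avoid both its ends. *)
Lemma sum_card_touching P k : #|P| = k ->
  (\sum_(ij in pairs P) #|touching P ij|
   = #|edges P| * (k * k.-1 - (k - 2) * (k - 2).-1))%N.
Proof.
move=> Pk.
transitivity (\sum_(ij in pairs P)
    \sum_(ac in edges P | ij \notin pairs (P :\: [set ac.1; ac.2])) 1)%N.
  by apply: eq_bigr => ij _; rewrite sum1dep_card.
rewrite (exchange_big_dep (mem (edges P))) /=; last by move=> ? ? _ /andP[].
rewrite -sum_nat_const; apply: eq_bigr => -[a c] acP /=.
rewrite sum1dep_card -Pk -card_pairs.
move: (acP); rewrite mem_edges => /and3P[aP cP /e_neq ac].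
have <- : #|P :\: [set a; c]| = (#|P| - 2)%N.
  by rewrite cardsDS ?cards2 ?ac // subUset !sub1set aP.
rewrite -card_pairs -cardsDS.
  by apply: eq_card => ij; rewrite inE -mem_edges acP in_setD andbC.
apply/subsetP => ij; rewrite !inE => /and3P[/andP[_ ->] /andP[_ ->] ->] //.
Qed.

(** Avoidance is symmetric: for [P] containing [s] and [t], the pairs [ij] that leave both in place
    are exactly the pairs of [P :\: [set s; t]]. *)
Lemma sum_retained B k s t : (1 < k)%N -> (s, t) \in pairs B ->
  (\sum_(P in draws B k) \sum_(ij in pairs P) ((s, t) \in pairs (P :\: [set ij.1; ij.2]))
   = 'C(#|B| - 2, k - 2) * ((k - 2) * (k - 2).-1))%N.
Proof.
move=> k1 stB; rewrite -(card_draws_pair k1 stB) -sum_nat_const big_mkcond [RHS]big_mkcond /=.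
apply: eq_bigr => P _; rewrite [in RHS]inE; case: ifP => //= PB.
case: ifPn => [|nst]; last first.
  apply: big1 => ij _; apply/eqP; rewrite eqb0; apply: contra nst.
  by rewrite !inE /= => /and3P[/andP[_ ->] /andP[_ ->] ->].
rewrite inE /= => /and3P[sP tP st].
have <- : #|P :\: [set s; t]| = (k - 2)%N.
  by move: PB; rewrite inE cardsDS ?cards2 ?st ?subUset ?sub1set ?sP // => /andP[_ /eqP ->].
rewrite -card_pairs -sum1_card big_mkcond [RHS]big_mkcond /=.
apply: eq_bigr => -[i j] _; rewrite !inE /= sP tP st !negb_or.
rewrite ![s == _]eq_sym ![t == _]eq_sym.
case: (i \in P); case: (j \in P); case: (i == j); case: (i == s); case: (i == t);
  by case: (j == s); case: (j == t).
Qed.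

(** Each neighbour lies together with [s] and [t] in ['C(N - 3, k - 3)] sets, where [N = #|B|], and
    [(N - 2) 'C(N - 3, k - 3) = (k - 2) 'C(N - 2, k - 2)]. The factor on the left avoids a
    division. *)
Lemma sum_card_edge_nbrs B k s t : (1 < k)%N -> (s, t) \in pairs B ->
  ((#|B| - 2) * \sum_(P in draws B k | (s, t) \in pairs P) #|P :&: edge_nbrs B (s, t)|
   = (k - 2) * 'C(#|B| - 2, k - 2) * #|edge_nbrs B (s, t)|)%N.
Proof.
move=> k1 stB.
transitivity ((#|B| - 2) * \sum_(P in draws B k | (s, t) \in pairs P)
    \sum_(u in edge_nbrs B (s, t) | u \in P) 1)%N.
  congr (_ * _)%N; apply: eq_bigr => P _; rewrite sum1dep_card.
  by apply: eq_card => u; rewrite in_setI [RHS]inE andbC.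
rewrite (exchange_big_dep (mem (edge_nbrs B (s, t)))) /=; last by move=> ? ? _ /andP[].
rewrite big_distrr /= mulnC -sum_nat_const; apply: eq_bigr => u uN.
have [sB tB st] : [/\ s \in B, t \in B & s != t] by apply/and3P; rewrite inE in stB.
have [us ut uB] : [/\ u != s, u != t & u \in B].
  by move: uN; rewrite !inE negb_or => /andP[/andP[/andP[]]].
have c3 : #|[set s; t; u]| = 3%N.
  by rewrite setUC cardsU1 !inE (negPf us) (negPf ut) cards2 st.
have sub : [set s; t; u] \subset B by rewrite !subUset !sub1set sB tB.
have N3 : (2 < #|B|)%N by rewrite -c3 subset_leq_card.
(* The case [k = 2] is separate: no [P] contains three points, whereas truncated subtraction would
   turn ['C(N - 3, k - 3)] into 1. *)
rewrite sum1dep_card; case: (ltnP 2 k) => k2; last first.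
  have -> : (k = 2)%N by apply/eqP; rewrite eqn_leq k1 k2.
  rewrite [X in (_ * X)%N]eq_card0 ?muln0 // => P; rewrite [LHS]inE uN /=.
  apply/negP => /andP[/andP[]]; rewrite inE => /andP[_ /eqP P2].
  rewrite inE /= => /and3P[sP tP _] uP.
  suff : (#|[set s; t; u]| <= #|P|)%N by rewrite c3 P2.
  by apply: subset_leq_card; rewrite !subUset !sub1set sP tP.
have -> : #|[set P : {set T} | ((P \in draws B k) && ((s, t) \in pairs P))
                 && ((u \in edge_nbrs B (s, t)) && (u \in P))]| = 'C(#|B| - 3, k - 3).
  rewrite -c3 -card_drawsU ?c3 //; apply: eq_card => P.
  rewrite inE uN [RHS]inE !subUset !sub1set /= -!andbA; congr (_ && _).
  by rewrite inE /= st andbT -!andbA.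
case: #|B| N3 => [|[|[|N]]] // _; case: k k1 k2 => [|[|[|k]]] // _ _.
by rewrite !subSS !subn0 mul_bin_diag.
Qed.

End Graph.

Lemma natr_pairs (R : realFieldType) m : (m * m.-1)%:R = m%:R * (m%:R - 1) :> R.
Proof. by case: m => [|m]; rewrite ?mul0r // natrM -natr1 addrK. Qed.

Lemma natr_bin2 (R : realFieldType) m : 'C(m, 2)%:R = m%:R * (m%:R - 1) / 2 :> R.
Proof.
apply: (@mulIf _ 2); first by rewrite pnatr_eq0.
by rewrite mulfVK ?pnatr_eq0 // -natr_pairs -[in RHS](bin1 m.-1) mul_bin_diag -natrM mulnC.
Qed.

(** * The edge polynomial and its derivative *)

Section EdgePolynomial.
Variables (R : realFieldType) (T : finType) (e : rel T) (B : {set T}) (k : nat).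
Hypothesis e_asym : forall s t, e s t -> ~~ e t s.
Hypotheses (k1 : (1 < k)%N) (B3 : (2 < #|B|)%N).
Implicit Types (P : {set T}) (st : T * T).

Local Notation n := (#|B|%:R : R).
Local Notation M := (#|edges e B|%:R : R).
Local Notation c := ('C(#|B| - 2, k - 2)%:R : R).

(** Both sides count the [k]-subsets of [B] with a chosen ordered pair of distinct elements. *)
Lemma bin_sub2 : 'C(#|B|, k)%:R * (k%:R * (k%:R - 1)) = n * (n - 1) * c.
Proof.
rewrite -!natr_pairs -!natrM; congr (_%:R).
case: #|B| B3 => [|[|N]] // _; case: k k1 => [|[|j]] // _.
rewrite !subSS !subn0 [LHS]mulnC [(j.+2 * _)%N]mulnC -mulnA -mul_bin_diag.
by rewrite mulnCA -mul_bin_diag mulnA.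
Qed.

Definition edge_poly : {poly R} := \sum_(P in draws B k) 'X^#|edges e P|.

Lemma horner_edge_poly x : edge_poly.[x] = \sum_(P in draws B k) x ^+ #|edges e P|.
Proof. by rewrite horner_sum; apply: eq_bigr => P _; rewrite hornerXn. Qed.

(** The exponent brought down by differentiation is the number of edges of [P], hence one term for
    each edge of [P]; then the two sums are exchanged. *)
Lemma deriv_edge_poly x : edge_poly^`().[x]
  = \sum_(st in edges e B) \sum_(P in draws B k | st \in pairs P) x ^+ #|edges e P|.-1.
Proof.
rewrite raddf_sum horner_sum.
rewrite -(sum_edges_draws _ _ _ (fun P _ => x ^+ #|edges e P|.-1)).
by apply: eq_bigr => P _; rewrite /= derivXn hornerMn hornerXn sumr_const.
Qed.

(** Each [P] is repeated once per ordered pair in it, so that the sum runs over the same index set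
    as the left side of [sum_move2]. *)
Lemma card_pairs_horner x : k%:R * (k%:R - 1) * edge_poly.[x]
  = \sum_(ij in pairs B) \sum_(P in draws B k | ij \in pairs P) x ^+ #|edges e P|.
Proof.
rewrite (sum_pairs_draws _ _ (fun P _ => x ^+ #|edges e P|)) horner_edge_poly mulr_sumr.
apply: eq_bigr => P; rewrite inE => /andP[_ /eqP Pk].
by rewrite sumr_const card_pairs Pk -natr_pairs mulr_natl.
Qed.

Lemma edges_pairs s t : (s, t) \in edges e B -> (s, t) \in pairs B.
Proof. by rewrite inE => /andP[]. Qed.

Section Bounds.
Variable x : R.
Hypotheses (x0 : 0 <= x) (x1 : x <= 1).

(** Sum of [removal_bound] over all [ij] and [P]. The term [(k - 2) (k - 3)] comes from
    [sum_retained], and [4 k - 6 = k (k - 1) - (k - 2) (k - 3)] from [sum_card_touching], each of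
    the [M] edges lying in [c] sets. *)
Lemma edge_upper st : st \in edges e B ->
  n * (n - 1) * \sum_(P in draws B k | st \in pairs P) x ^+ #|edges e P|.-1
    - k%:R * (k%:R - 1) * edge_poly.[x]
  <= c * ((k%:R - 2) * (k%:R - 3) + M * (4 * k%:R - 6)).
Proof.
case: st => s t stB; have st2 := edges_pairs stB.
rewrite card_pairs_horner -natr_pairs -card_pairs mulr_natl.
rewrite -(sum_move2 k (fun P => x ^+ #|edges e P|.-1) st2) -sumrB.
under eq_bigr do rewrite -sumrB.
apply: (@le_trans _ _ (\sum_(ij in pairs B) \sum_(P in draws B k | ij \in pairs P)
   (((s, t) \in pairs (P :\: [set ij.1; ij.2])) + #|touching e P ij|)%:R)).
  apply: ler_sum => ij _; apply: ler_sum => P; rewrite inE => /andP[/andP[PB _] ijP].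
  exact: (removal_bound e_asym x0 x1 stB).
under eq_bigr do rewrite -natr_sum.
rewrite -natr_sum (sum_pairs_draws _ _ (fun P ij =>
  ((s, t) \in pairs (P :\: [set ij.1; ij.2])) + #|touching e P ij|)%N).
under eq_bigr do rewrite big_split /=.
rewrite big_split /= sum_retained //.
have -> : (\sum_(P in draws B k) \sum_(ij in pairs P) #|touching e P ij|
  = #|edges e B| * 'C(#|B| - 2, k - 2) * (k * k.-1 - (k - 2) * (k - 2).-1))%N.
  transitivity (\sum_(P in draws B k) \sum_(st in edges e P) (k * k.-1 - (k - 2) * (k - 2).-1))%N.
    apply: eq_bigr => P; rewrite inE => /andP[_ /eqP Pk].
    by rewrite (sum_card_touching e_asym Pk) sum_nat_const.
  rewrite (sum_edges_draws _ _ _ (fun _ _ => _)).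
  rewrite -mulnA -sum_nat_const; apply: eq_bigr => -[a d] /edges_pairs adB.
  by rewrite -(card_draws_pair k1 adB) -sum_nat_const; apply: eq_bigl => P; rewrite inE.
rewrite natrD natrM natr_pairs 2!natrM [X in _ + _ * X]natrB ?natr_pairs; last first.
  by rewrite leq_mul ?leq_subr // -!subn1 leq_sub2r // leq_subr.
by rewrite natrB // le_eqVlt; apply/orP; left; apply/eqP; ring.
Qed.

(** Sum of [creation_bound] over all [ij] and [P]; the factor [n - 2] is the one of
    [sum_card_edge_nbrs]. *)
Lemma edge_lower st : st \in edges e B ->
  (n - 2) * (k%:R * (k%:R - 1) * edge_poly.[x]
    - n * (n - 1) * \sum_(P in draws B k | st \in pairs P) x ^+ #|edges e P|.-1)
  <= n * (n - 1) * c * (k%:R - 2) * #|edge_nbrs e B st|%:R.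
Proof.
case: st => s t stB; have st2 := edges_pairs stB.
have n2 : n - 2 = (#|B| - 2)%:R by rewrite natrB // ltnW.
have -> : n * (n - 1) * c * (k%:R - 2) * #|edge_nbrs e B (s, t)|%:R
  = (n - 2) * (\sum_(ij in pairs B) \sum_(P in draws B k | ij \in pairs P)
      #|move2 s t ij @: P :&: edge_nbrs e B (s, t)|%:R).
  rewrite (sum_move2 k (fun P => #|P :&: edge_nbrs e B (s, t)|%:R) st2).
  rewrite -natr_sum -(mulr_natl _ #|pairs B|) mulrCA n2 -natrM sum_card_edge_nbrs //.
  by rewrite !natrM card_pairs natr_pairs natrB // !mulrA; ring.
apply: ler_wpM2l; first by rewrite n2 ler0n.
rewrite card_pairs_horner -natr_pairs -card_pairs mulr_natl.
rewrite -(sum_move2 k (fun P => x ^+ #|edges e P|.-1) st2) -sumrB.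
apply: ler_sum => ij _; rewrite -sumrB.
apply: ler_sum => P; rewrite inE => /andP[/andP[PB _] ijP].
exact: (creation_bound e_asym x0 x1 stB).
Qed.

(** [edge_lower] and [edge_upper] are summed over the edges of [B]. Their total errors are absorbed
    by the second and third hypotheses respectively, in view of [lambda * 'C(#|B|, k) = M * c]. *)
Lemma edge_poly_growth (d lambda : R) :
  lambda = k%:R * (k%:R - 1) * M / (n * (n - 1)) ->
  (k%:R - 2) / (n - 2) * \sum_(st in edges e B) #|edge_nbrs e B st|%:R <= d * M ->
  ((k%:R - 2) * (k%:R - 3) + (4 * k%:R - 6) * M) / (n * (n - 1)) <= d ->
  `|edge_poly^`().[x] - lambda * edge_poly.[x]| <= lambda * 'C(#|B|, k)%:R * d.
Proof.
move=> lambdaE dA dB.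
have n3 : 3 <= n by rewrite ler_nat.
have nn : 0 < n * (n - 1) by rewrite mulr_gt0 //; lra.
have lamC : lambda * 'C(#|B|, k)%:R = M * c.
  have /(congr1 (fun y => M * y / (n * (n - 1)))) := bin_sub2.
  rewrite lambdaE => H; rewrite (_ : M * c = M * (n * (n - 1) * c) / (n * (n - 1))).
    by rewrite -H; ring.
  by field; apply/andP; split; lra.
have lamE : lambda * edge_poly.[x] = (n * (n - 1))^-1 *
   (\sum_(st in edges e B) k%:R * (k%:R - 1) * edge_poly.[x]).
  by rewrite sumr_const -(mulr_natl _ #|edges e B|) lambdaE; ring.
have derE : edge_poly^`().[x] = (n * (n - 1))^-1 * (\sum_(st in edges e B)
  n * (n - 1) * \sum_(P in draws B k | st \in pairs P) x ^+ #|edges e P|.-1).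
  by rewrite -mulr_sumr mulKf ?gt_eqF // deriv_edge_poly.
rewrite lamC ler_norml; apply/andP; split.
  rewrite lerNl opprB lamE derE -mulrBr -sumrB ler_pdivrMl //.
  rewrite -(@ler_pM2l _ (n - 2)); last by lra.
  rewrite mulr_sumr; apply: le_trans; first by apply: ler_sum => st stB; apply: edge_lower stB.
  rewrite -mulr_sumr.
  have -> : n * (n - 1) * c * (k%:R - 2) * \sum_(st in edges e B) #|edge_nbrs e B st|%:R
    = (n - 2) * (n * (n - 1) * c) *
      ((k%:R - 2) / (n - 2) * \sum_(st in edges e B) #|edge_nbrs e B st|%:R).
    by field; lra.
  have -> : (n - 2) * (n * (n - 1) * (M * c * d)) = (n - 2) * (n * (n - 1) * c) * (d * M).
    by ring.
  by apply: ler_wpM2l => //; rewrite !mulr_ge0 //; lra.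
rewrite lamE derE -mulrBr -sumrB ler_pdivrMl //.
apply: le_trans; first by apply: ler_sum => st stB; apply: edge_upper stB.
rewrite sumr_const -[leLHS]mulr_natl.
have -> : n * (n - 1) * (M * c * d) = M * (c * (d * (n * (n - 1)))) by ring.
do 2![apply: ler_wpM2l; first exact: ler0n].
by move: dB; rewrite ler_pdivrMr // [M * _]mulrC.
Qed.

End Bounds.
End EdgePolynomial.

(** * Poisson approximation *)

Section ExpPoly.
Variable R : realType.
Implicit Types (p : {poly R}) (l D : R).

(* The hypothesis makes exp(- l x) p(x) nonincreasing. *)
Lemma horner_expR_le p l :
  (forall x : R, 0 <= x <= 1 -> p^`().[x] <= l * p.[x]) -> expR (- l) * p.[1] <= p.[0].
Proof.
move=> ple; pose f (x : R) : R := expR (- l * x) * p.[x].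
have df (x : R) : is_derive x 1 f (expR (- l * x) * (p^`().[x] - l * p.[x])).
  have dl : is_derive x 1 (fun y : R => - l * y) (- l).
    by apply: is_derive_eq; rewrite [LHS]mulr1.
  have de : is_derive x 1 (fun y => expR (- l * y)) (expR (- l * x) * - l).
    exact: (@is_derive1_comp _ expR (fun y => - l * y)).
  apply: (is_derive_eq (is_deriveM de (is_derive_poly p x))).
  rewrite /GRing.scale /=; ring.
have [y y01 fE] : exists2 y : R, y \in `[0, 1]%R &
    f 1 - f 0 = expR (- l * y) * (p^`().[y] - l * p.[y]) * (1 - 0).
  apply: (@MVT_segment _ f) => //; apply/continuous_subspaceT => x.
  by apply: differentiable_continuous; apply/derivable1_diffP; case: (df x).
have : f 1 - f 0 <= 0.
  rewrite fE subr0 mulr1 pmulr_rle0 ?expR_gt0 // subr_le0; apply: ple.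
  by move: y01; rewrite in_itv.
by rewrite /f subr_le0 mulr1 mulr0 expR0 mul1r.
Qed.

(** Both [p + D] and [D - p] satisfy the hypothesis of [horner_expR_le]: the constant [D] adds
    [l * D] on the right and nothing to the derivative. *)
Lemma horner_expR_dist p l D :
  (forall x : R, 0 <= x <= 1 -> `|p^`().[x] - l * p.[x]| <= l * D) ->
  `|p.[0] - p.[1] * expR (- l)| <= D * (1 - expR (- l)).
Proof.
move=> pD; rewrite ler_norml; apply/andP; split.
  have /= := @horner_expR_le (p + D%:P) l.
  rewrite !hornerE => H.
  suff /H : forall x : R, 0 <= x <= 1 -> (p + D%:P)^`().[x] <= l * (p + D%:P).[x] by lra.
  move=> x /pD; rewrite ler_norml => /andP[_].
  by rewrite derivD derivC !hornerE mulrDr; lra.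
have /= := @horner_expR_le (D%:P - p) l.
rewrite !hornerE => H.
suff /H : forall x : R, 0 <= x <= 1 -> (D%:P - p)^`().[x] <= l * (D%:P - p).[x] by lra.
move=> x /pD; rewrite ler_norml => /andP[+ _].
by rewrite derivB derivC !hornerE mulrBr; lra.
Qed.

End ExpPoly.

Section PoissonBound.
Variables (R : realType) (T : finType) (e : rel T) (B : {set T}) (k : nat).
Hypothesis e_asym : forall s t, e s t -> ~~ e t s.
Hypotheses (k1 : (1 < k)%N) (B3 : (2 < #|B|)%N).

Local Notation n := (#|B|%:R : R).
Local Notation M := (#|edges e B|%:R : R).

(** The bounds by [d] and [lambda * d] follow from [1 - expR (- lambda)] being at most 1 and at most
    [lambda]; the bound by 1 holds because both compared numbers lie between 0 and ['C(#|B|, k)]. *)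
Lemma isolated_draws_poisson (d lambda : R) :
  lambda = 'C(k, 2)%:R * M / 'C(#|B|, 2)%:R ->
  (k%:R - 2) / (n - 2) * \sum_(st in edges e B) #|edge_nbrs e B st|%:R <= d * M ->
  ((k%:R - 2) * (k%:R - 3) + (4 * k%:R - 6) * M) / (n * (n - 1)) <= d ->
  `|#|[set P in draws B k | edges e P == set0]|%:R - 'C(#|B|, k)%:R * expR (- lambda)|
  <= 'C(#|B|, k)%:R * Num.min d (Num.min (lambda * d) 1).
Proof.
move=> lambdaE dA dB; set C := 'C(_, _)%:R.
have n3 : 3 <= n by rewrite ler_nat.
have k2 : 2 <= k%:R :> R by rewrite ler_nat.
have lambda2 : lambda = k%:R * (k%:R - 1) * M / (n * (n - 1)).
  rewrite lambdaE !natr_bin2; field; apply/andP; split; lra.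
have lambda0 : 0 <= lambda by rewrite lambdaE divr_ge0 // mulr_ge0.
have C0 : 0 <= C by rewrite ler0n.
have d0 : 0 <= d.
  apply: le_trans dB; apply: divr_ge0; last by apply: mulr_ge0; lra.
  apply: addr_ge0; last by apply: mulr_ge0 => //; lra.
  (* The product [(k - 2) (k - 3)] is negative strictly between 2 and 3, so integrality of [k] is
     used. *)
  have [k2'|k3] := leqP k 2.
    by rewrite (_ : k = 2%N) ?subrr ?mul0r //; apply/eqP; rewrite eqn_leq k2'.
  by rewrite mulr_ge0 // subr_ge0 ler_nat // ltnW.
(* At 0 exactly the sets without edges contribute, since [0 ^+ 0 = 1]. *)
have card0 : (edge_poly R e B k).[0] = #|[set P in draws B k | edges e P == set0]|%:R.
  rewrite horner_edge_poly -sum1_card natr_sum big_mkcond [RHS]big_mkcond /=.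
  apply: eq_bigr => P _; rewrite [in RHS]inE expr0n cards_eq0.
  by case: (P \in draws B k); case: eqP.
have card1 : (edge_poly R e B k).[1] = C.
  rewrite horner_edge_poly; under eq_bigr do rewrite expr1n.
  by rewrite sumr_const cards_draws.
have dist := @horner_expR_dist R (edge_poly R e B k) lambda (C * d).
rewrite card0 card1 in dist.
have {}dist : `|#|[set P in draws B k | edges e P == set0]|%:R - C * expR (- lambda)|
    <= C * d * (1 - expR (- lambda)).
  apply: dist => x /andP[x0 x1]; rewrite mulrA.
  exact: (edge_poly_growth e_asym k1 B3 x0 x1 lambda2).
have exp0 : 0 < expR (- lambda) by exact: expR_gt0.
have exp1 : expR (- lambda) <= 1 by rewrite -[leRHS]expR0 ler_expR oppr_le0.
have Zle : #|[set P in draws B k | edges e P == set0]|%:R <= C.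
  rewrite /C -cards_draws ler_nat; apply: subset_leq_card.
  by apply/subsetP => P; rewrite inE => /andP[].
(* If [C = 0], then [dist] already gives the bound; otherwise [C] can be divided out. *)
rewrite -[leLHS]mul1r; case: (ltgtP 0 C) C0 => // [Cp _|C0' _]; last first.
  by move: dist; rewrite -C0' !mul0r mul1r.
rewrite mul1r -ler_pdivrMl // !le_min !ler_pdivrMl //; apply/and3P; split.
- apply: le_trans dist _; rewrite ler_piMr ?mulr_ge0 //; lra.
- apply: le_trans dist _; rewrite -mulrA ler_wpM2l // mulrC ler_wpM2r //.
  by have := expR_ge1Dx (- lambda); lra.
- rewrite mulr1 ler_norml; have : 0 <= C * expR (- lambda) <= C.
    by rewrite mulr_ge0 //= ?ler_piMr // ltW.
  have : 0 <= #|[set P in draws B k | edges e P == set0]|%:R :> R by [].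
  move: Zle; rewrite -/C; lra.
Qed.

End PoissonBound.

(** Common form of the rook and file bounds, [X] standing for the sums [s2] and [s3]. The first two
    terms of [d] add up to [(4 k - 6) M / (N (N - 1))], and [s4] dominates
    [(k - 2) (k - 3) / (N (N - 1))]. *)
Lemma poisson_bound_of_degrees (R : realType) (T : finType) (e : rel T) (B : {set T})
    (N M k Z : nat) (X d lambda : R) :
  let r : R := Num.min d (Num.min (lambda * d) 1) in
  (forall s t, e s t -> ~~ e t s) ->
  #|B| = N -> #|edges e B| = M -> #|[set P in draws B k | edges e P == set0]| = Z ->
  (2 <= k)%N -> (k <= N)%N -> (3 <= N)%N ->
  lambda = 'C(k, 2)%:R * M%:R / 'C(N, 2)%:R ->
  d = M%:R / 'C(N, 2)%:R + 2 * (k%:R - 2) * M%:R / 'C(N, 2)%:R + X / M%:R + s4 R N k ->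
  (k%:R - 2) / (N%:R - 2) * \sum_(st in edges e B) #|edge_nbrs e B st|%:R <= X ->
  'C(N, k)%:R * expR (- lambda) * (1 - expR lambda * r) <= Z%:R
    <= 'C(N, k)%:R * expR (- lambda) * (1 + expR lambda * r).
Proof.
move=> r e_asym <- <- <- {N M Z}; set N := #|B|; set M := #|edges e B|.
set Z := #|[set _ in _ | _]| => k_ge2 kN N3 lambdaE dE XE.
have n3 : 3 <= N%:R :> R by rewrite ler_nat.
have k2 : 2 <= k%:R :> R by rewrite ler_nat.
have nn : 0 < N%:R * (N%:R - 1) :> R by rewrite mulr_gt0 //; lra.
have X0 : 0 <= X.
  apply: le_trans XE; rewrite mulr_ge0 ?divr_ge0 ?sumr_ge0 //; lra.
have M0 : 0 <= M%:R :> R by [].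
have dM : M%:R / 'C(N, 2)%:R + 2 * (k%:R - 2) * M%:R / 'C(N, 2)%:R
    = (4 * k%:R - 6) * M%:R / (N%:R * (N%:R - 1)) :> R.
  rewrite natr_bin2; field; apply/andP; split; lra.
have s4_ge : (k%:R - 2) * (k%:R - 3) / (N%:R * (N%:R - 1)) <= s4 R N k.
  rewrite /s4 natr_bin2 invf_div [leRHS]mulrA ler_pM2r ?invr_gt0 //; nra.
have s4_ge0 : 0 <= s4 R N k.
  rewrite /s4 divr_ge0 //; nra.
have kM0 : 0 <= (4 * k%:R - 6) * M%:R / (N%:R * (N%:R - 1)) :> R.
  by rewrite divr_ge0 ?(ltW nn) // mulr_ge0 //; lra.
have XM0 : 0 <= X / M%:R by rewrite divr_ge0.
have : `|Z%:R - 'C(N, k)%:R * expR (- lambda)| <= 'C(N, k)%:R * r.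
  apply: isolated_draws_poisson => //; rewrite -/N -/M.
    (* Without edges both sides are 0; otherwise multiplying [d] by [M] recovers [X] from
       [X / M]. *)
    have [M_0|M_gt0] := posnP M.
      by rewrite big_pred0 ?M_0 ?mulr0 // => st; rewrite (cards0_eq M_0) inE.
    apply: le_trans XE _; rewrite dE dM 2!mulrDl divfK; last by rewrite pnatr_eq0 -lt0n.
    by rewrite -addrA addrCA lerDl addr_ge0 // mulr_ge0.
  by rewrite mulrDl dE dM; lra.
(* The factor [expR lambda] in front of [r] cancels [expR (- lambda)], so both inequalities together
   are the distance bound just proved. *)
have expK : expR (- lambda) * expR lambda = 1 by rewrite -expRD addNr expR0.
rewrite ler_distl mulrBr mulrDr mulr1 -mulrA (mulrA (expR _)) expK mul1r.
by rewrite [_ - _]addrC.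
Qed.

(** * Ferrers boards *)

Section Ferrers.
Variable b : seq nat.
Hypothesis hb : is_partition b.

(** Past the last column the default value 0 is also the count, because no row is longer than the
    first. *)
Lemma nth_conj_part j : nth 0%N (conj_part b) j = count (leq j.+1) b.
Proof.
rewrite /conj_part; have [jb|bj] := ltnP j (part b 1).
  by rewrite (nth_map 0%N) ?size_iota // nth_iota.
rewrite nth_default ?size_map ?size_iota //; apply/esym/eqP.
rewrite -leqn0 leqNgt -has_count; apply/hasPn => x xb; rewrite -leqNgt.
apply: leq_trans bj; move: hb xb => /andP[srt _].
case: b srt => [|y s] //=; rewrite inE => /(order_path_min (rev_trans leq_trans)) /allP ys.
by case/orP => [/eqP ->|/ys].
Qed.

(** Row and column descriptions of the diagram agree. By induction on the rows: as they decrease, if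
    the first one does not reach column [j], none does. *)
Lemma conj_part_dual i j : (j < nth 0 b i)%N = (i < nth 0 (conj_part b) j)%N.
Proof.
rewrite nth_conj_part; move: hb => /andP[+ _].
elim: b i => [|y s IH] i srt; first by rewrite nth_nil.
have /= := srt; move/(order_path_min (rev_trans leq_trans))/allP => ys.
case: i => [|i] /=; last first.
  rewrite IH; last exact: path_sorted srt.
  have [//|yj] := leqP j.+1 y; rewrite add0n.
  have -> : count (leq j.+1) s = 0%N.
    apply/eqP; rewrite -leqn0 leqNgt -has_count; apply/hasPn => x /ys xy.
    by rewrite -ltnNge ltnS (leq_trans xy).
  by [].
have [//|yj] := leqP j.+1 y; rewrite add0n.
apply/esym/negbTE; rewrite -has_count; apply/hasPn => x /ys xy.
by rewrite -ltnNge ltnS (leq_trans xy).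
Qed.

End Ferrers.

(** Passes from ordinals, which start at 0, to the positions of [s3], which start at 1; hence the
    predecessors. *)
Lemma sum_ord_pairs (V : nmodType) (l r : nat) (G : nat -> nat -> V) : (r <= l)%N ->
  \sum_(i < l) \sum_(j < l | (i < j < r)%N) G i j
  = \sum_(1 <= i < r) \sum_(i.+1 <= j < r.+1) G i.-1 j.-1.
Proof.
move=> rl; rewrite big_add1 /=; under [RHS]eq_bigr do rewrite big_add1 /=.
transitivity (\sum_(0 <= i < l) \sum_(i.+1 <= j < r) G i j).
  rewrite big_mkord; apply: eq_bigr => i _; rewrite big_geq_mkord.
  by rewrite (big_ord_widen_cond _ (fun j => (i < j)%N) _ rl).
(* For [i] at least [r.-1] the inner sum is empty. *)
rewrite (big_cat_nat (n := r.-1)) //=; last by rewrite (leq_trans (leq_pred _)).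
rewrite [X in _ + X]big_nat_cond [X in _ + X]big1 ?addr0 // => i.
by rewrite andbT => /andP[ri _]; rewrite big_geq // (leq_trans (leqSpred r)).
Qed.

Lemma card_ord_pairs r : (\sum_(1 <= i < r) \sum_(i.+1 <= j < r.+1) 1)%N = 'C(r, 2).
Proof.
case: r => [|r]; first by rewrite big_geq.
rewrite -bin2_sum big_nat_rev [RHS]big_ltn // add0n.
by rewrite big_nat_cond [RHS]big_nat_cond; apply: eq_bigr => i; rewrite sum_nat_const_nat; lia.
Qed.

(** * Attacks along the lines of a grid *)

Section Lines.
Variables (m n : nat) (T : finType) (x : T -> 'I_m) (y : T -> 'I_n).
Implicit Types (s t u : T).

(** With [x] the row and [y] the column these are the attacks within a row, each oriented from left
    to right; exchanging [x] and [y] gives the columns, so that one proof serves both. *)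
Definition line_edge : rel T := fun s t => (x s == x t) && (y s < y t)%N.

Lemma line_edge_asym s t : line_edge s t -> ~~ line_edge t s.
Proof. by case/andP => _ st; rewrite negb_and -leqNgt ltnW ?orbT. Qed.

(** Two distinct points on a line have different [y], so one of the two orientations is an edge. *)
Lemma distinct_linesE (P : {set T}) : injective (fun s => (x s, y s)) ->
  [forall s in P, forall t in P, (s != t) ==> (x s != x t)] = (edges line_edge P == set0).
Proof.
move=> xy_inj; apply/idP/eqP => [/forall_inP dP|P0].
  apply/setP => -[s t]; rewrite (mem_edges line_edge_asym) inE; apply/negP.
  case/and3P => sP tP /[dup] /(e_neq line_edge_asym) st /andP[st1 _].
  by have /forall_inP /(_ t tP) := dP s sP; rewrite st st1.
apply/forall_inP => s sP; apply/forall_inP => t tP; apply/implyP; apply: contra => st1.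
have nedge u v : u \in P -> v \in P -> line_edge u v = false.
  move=> uP vP; apply/negP => uv; have : (u, v) \in edges line_edge P.
    by rewrite (mem_edges line_edge_asym) uP vP.
  by rewrite P0 inE.
have := nedge s t sP tP; have := nedge t s tP sP.
rewrite /line_edge st1 eq_sym st1 /= => h1 h2; apply/eqP/xy_inj; congr (_, _).
  exact/eqP.
by apply/val_inj/eqP; rewrite eqn_leq leqNgt h1 leqNgt h2.
Qed.

Variable g : 'I_m -> 'I_n -> T.
Hypotheses (xg : forall i j, x (g i j) = i) (yg : forall i j, y (g i j) = j).
Hypothesis gxy : forall s, g (x s) (y s) = s.

Variables (p : seq nat) (S : {set T}).
Hypothesis Sp : forall s, (s \in S) = (y s < nth 0 p (x s))%N.
Hypothesis pn : forall i, (nth 0 p i <= n)%N.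

Lemma card_line i : #|[set u in S | x u == i]| = nth 0%N p i.
Proof.
have inj : injective (g i) by move=> j j' /(congr1 y); rewrite !yg.
transitivity #|[set g i j | j : 'I_n & (j < nth 0 p i)%N]|.
  apply: eq_card => u; rewrite !inE; apply/andP/imsetP => [[uS /eqP xu]|[j]].
    by exists (y u); rewrite ?inE -xu ?gxy // -Sp.
  by rewrite inE => ji ->; rewrite Sp xg yg ji.
rewrite card_imset // -sum1dep_card (big_ord_narrow (pn i)).
by rewrite sum1_card card_ord.
Qed.

(** Through [g], an edge is a line [i] with positions [j < j']; the larger position lying in [S]
    implies it for the smaller. *)
Lemma sum_line_edges (V : nmodType) (F : T * T -> V) :
  \sum_(st in edges line_edge S) F st
  = \sum_(i < m) \sum_(j < n) \sum_(j' < n | (j < j' < nth 0 p i)%N) F (g i j, g i j').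
Proof.
under [RHS]eq_bigr do rewrite pair_big_dep /=.
rewrite pair_big_dep /=.
rewrite (reindex (fun a : 'I_m * ('I_n * 'I_n) => (g a.1 a.2.1, g a.1 a.2.2))) /=.
  apply: eq_bigl => -[i [j j']] /=.
  rewrite (mem_edges line_edge_asym) !Sp /line_edge !xg !yg eqxx /=.
  have [ij|_] := ltnP j j'; rewrite ?andbF //= andbT andbC.
  by have [j'i|_] := ltnP j' (nth 0%N p i); rewrite ?andbF //= (ltn_trans ij).
exists (fun st => (x st.1, (y st.1, y st.2))) => [[i [j j']] _|[s t]] /=.
  by rewrite xg !yg.
rewrite [_ \in _](mem_edges line_edge_asym) => /and3P[_ _ /andP[/eqP xst _]] /=.
by rewrite gxy xst gxy.
Qed.

Lemma card_line_edges : size p = m -> #|edges line_edge S| = pair_count p.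
Proof.
move=> pm; rewrite -sum1_card sum_line_edges /pair_count (big_nth 0%N) big_mkord pm.
apply: eq_bigr => i _; rewrite -card_ord_pairs -(sum_ord_pairs (fun _ _ => 1%N) (pn i)).
by [].
Qed.

End Lines.

Section EdgeNeighbours.
Variables (R : realType) (m n : nat) (T : finType) (x : T -> 'I_m) (y : T -> 'I_n).
Variable g : 'I_m -> 'I_n -> T.
Hypotheses (xg : forall i j, x (g i j) = i) (yg : forall i j, y (g i j) = j).
Hypothesis gxy : forall s, g (x s) (y s) = s.
Variables (p q : seq nat) (S : {set T}).
Hypothesis Sp : forall s, (s \in S) = (y s < nth 0 p (x s))%N.
Hypothesis Sq : forall s, (s \in S) = (x s < nth 0 q (y s))%N.
Hypothesis pn : forall i, (nth 0 p i <= n)%N.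
Hypothesis qm : forall j, (nth 0 q j <= m)%N.
Variable e : rel T.
Hypothesis e_line : forall u v, e u v -> line_edge x y u v || line_edge y x u v.

(** A neighbour lies on the line through [s] and [t], which has [p - 2] further points, or on the
    crossing line of [s] or of [t], with [q - 1] further points each. The 4 on the left avoids
    truncated subtraction. *)
Lemma card_edge_nbrs s t : (s, t) \in edges (line_edge x y) S ->
  (#|edge_nbrs e S (s, t)| + 4 <= nth 0 p (x s) + nth 0 q (y s) + nth 0 q (y t))%N.
Proof.
rewrite (mem_edges (@line_edge_asym _ _ _ _ _)) => /and3P[sS tS /[dup] st0 /andP[/eqP xst _]].
have st := e_neq (@line_edge_asym _ _ _ x y) st0.
have cl j : #|[set u in S | y u == j]| = nth 0%N q j.
  by apply: (card_line (g := fun j i => g i j)) => //.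
have sub : edge_nbrs e S (s, t) \subset ([set u in S | x u == x s] :\: [set s; t])
    :|: ([set u in S | y u == y s] :\ s) :|: ([set u in S | y u == y t] :\ t).
  apply/subsetP => u; rewrite !inE negb_or /= => /andP[/andP[/andP[us ut] uS] adj].
  have line v w : e v w -> (x v == x w) || (y v == y w).
    by move=> /e_line /orP[] /andP[->]; rewrite ?orbT.
  rewrite us ut uS /=; case/or4P: adj => /line.
  - by case/orP => ->; rewrite ?orbT.
  - by rewrite [x s == _]eq_sym [y s == _]eq_sym; case/orP => ->; rewrite ?orbT.
  - by rewrite -xst; case/orP => ->; rewrite ?orbT.
  - by rewrite -xst [x s == _]eq_sym [y t == _]eq_sym; case/orP => ->; rewrite ?orbT.
have := subset_leq_card sub.
rewrite -(card_line xg yg gxy Sp pn (x s)) -(cl (y s)) -(cl (y t)).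
rewrite [in X in (_ <= X)%N -> _]setUC => /leq_trans le.
have := le _ (leq_of_leqif (leq_card_setU _ _)).
have := leq_of_leqif (leq_card_setU ([set u in S | x u == x s] :\: [set s; t])
  ([set u in S | y u == y s] :\ s)).
rewrite (cardsD1 s [set u in S | y u == y s]) (cardsD1 t [set u in S | y u == y t]).
rewrite !inE sS tS !eqxx /= cardsDS ?cards2 ?st; last first.
  by rewrite subUset !sub1set !inE sS tS eqxx xst eqxx.
(* Makes the truncated subtraction of 2 exact. *)
have : (2 <= #|[set u in S | x u == x s]|)%N.
  apply: (@leq_trans #|[set s; t]|); first by rewrite cards2 st.
  by rewrite subset_leq_card // subUset !sub1set !inE sS tS eqxx xst eqxx.
lia.
Qed.

(** Writing ['C(r, 2)] as a sum over pairs of positions merges [s2] and [s3] into one sum over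
    edges, whose terms are the bounds of [card_edge_nbrs]. *)
Lemma s2D3 (N k : nat) : size p = m ->
  s2 R N k p + s3 R N k p q = (k%:R - 2) / (N%:R - 2) *
  \sum_(st in edges (line_edge x y) S) ((nth 0 p (x st.1))%:R - 2
     + ((nth 0 q (y st.1))%:R - 1) + ((nth 0 q (y st.2))%:R - 1)).
Proof.
move=> pm; rewrite (sum_line_edges xg yg gxy Sp) /s2 /s3 -mulrDr -mulrA; congr (_ * _).
rewrite -big_split /= mulr_sumr (big_nth 0%N) big_mkord pm; apply: eq_bigr => i _.
under [in RHS]eq_bigr do under eq_bigr do rewrite /= xg !yg.
set r := nth 0%N p i.
rewrite (sum_ord_pairs (fun j j' =>
  r%:R - 2 + ((nth 0 q j)%:R - 1) + ((nth 0 q j')%:R - 1)) (pn i)).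
rewrite -card_ord_pairs natr_sum mulr_suml -big_split mulr_sumr /=.
apply: eq_bigr => a _; rewrite natr_sum mulr_suml -big_split mulr_sumr /=.
by apply: eq_bigr => c _; rewrite /part; ring.
Qed.

Lemma sum_edge_nbrs_line (N k : nat) : size p = m -> (2 <= k)%N -> (2 <= N)%N ->
  (k%:R - 2) / (N%:R - 2) *
    \sum_(st in edges (line_edge x y) S) #|edge_nbrs e S st|%:R
  <= s2 R N k p + s3 R N k p q.
Proof.
move=> pm k2 N2; rewrite s2D3 //; apply: ler_wpM2l.
  by rewrite divr_ge0 // subr_ge0 ler_nat.
apply: ler_sum => -[s t] /card_edge_nbrs; rewrite -(ler_nat R) !natrD /=; lra.
Qed.

End EdgeNeighbours.

Section EdgesUnion.
Variables (T : finType) (e1 e2 : rel T) (S : {set T}).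

Lemma edgesU : edges (fun s t => e1 s t || e2 s t) S = edges e1 S :|: edges e2 S.
Proof. by apply/setP => st; rewrite !inE -andb_orr. Qed.

Hypothesis e12 : forall s t, e1 s t -> ~~ e2 s t.

Lemma edges_disjoint : [disjoint edges e1 S & edges e2 S].
Proof.
rewrite -setI_eq0 -subset0; apply/subsetP => st; rewrite !inE.
by case/andP => /andP[_ /e12 /negPf ->]; rewrite andbF.
Qed.

Lemma sum_edgesU (V : nmodType) (F : T * T -> V) :
  \sum_(st in edges (fun s t => e1 s t || e2 s t) S) F st
  = \sum_(st in edges e1 S) F st + \sum_(st in edges e2 S) F st.
Proof.
rewrite -bigU; last exact: edges_disjoint.
by rewrite edgesU; apply: eq_bigl => st; rewrite in_setU.
Qed.

Lemma card_edgesU : #|edges (fun s t => e1 s t || e2 s t) S| = (#|edges e1 S| + #|edges e2 S|)%N.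
Proof. by rewrite edgesU cardsU (disjoint_setI0 edges_disjoint) cards0 subn0. Qed.

End EdgesUnion.

Section Rooks.
Variables (m n : nat) (T : finType) (x : T -> 'I_m) (y : T -> 'I_n).

Definition rook_edge : rel T := fun s t => line_edge x y s t || line_edge y x s t.

Lemma line_edge_excl s t : line_edge x y s t -> ~~ line_edge y x s t.
Proof. by case/andP => /eqP xst _; rewrite negb_and xst ltnn orbT. Qed.

Lemma rook_edge_asym s t : rook_edge s t -> ~~ rook_edge t s.
Proof.
rewrite /rook_edge negb_or => /orP[] st; rewrite (line_edge_asym st) ?andbT.
  by case/andP: st => /eqP xst _; rewrite negb_and xst ltnn orbT.
by case/andP: st => /eqP yst _; rewrite negb_and yst ltnn orbT.
Qed.

Lemma card_rook_edges (S : {set T}) :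
  #|edges rook_edge S| = (#|edges (line_edge x y) S| + #|edges (line_edge y x) S|)%N.
Proof. exact: card_edgesU line_edge_excl. Qed.

Lemma sum_rook_edges (V : nmodType) (S : {set T}) (F : T * T -> V) :
  \sum_(st in edges rook_edge S) F st
  = \sum_(st in edges (line_edge x y) S) F st + \sum_(st in edges (line_edge y x) S) F st.
Proof. exact: (@sum_edgesU _ _ _ S line_edge_excl). Qed.

End Rooks.

(** * Rook and file placements on the board *)

Section Board.
Variable b : seq nat.
Hypothesis hb : is_partition b.

Local Notation row := (fun s : square b => s.1).
Local Notation col := (fun s : square b => s.2).

(** By duality, a column that reaches row [i] also reaches the first row. *)
Lemma nth_part_le i : (nth 0 b i <= part b 1)%N.
Proof.
rewrite leqNgt; apply/negP; rewrite (conj_part_dual hb) => lt.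
have : (part b 1 < nth 0 b 0)%N by rewrite (conj_part_dual hb) (leq_ltn_trans _ lt).
by rewrite /part ltnn.
Qed.

Lemma nth_conj_part_le j : (nth 0 (conj_part b) j <= size b)%N.
Proof. by rewrite (nth_conj_part hb) count_size. Qed.

Lemma mem_board_row (s : square b) : (s \in board b) = (s.2 < nth 0 b s.1)%N.
Proof. by rewrite inE. Qed.

Lemma mem_board_col (s : square b) : (s \in board b) = (s.1 < nth 0 (conj_part b) s.2)%N.
Proof. by rewrite mem_board_row (conj_part_dual hb). Qed.

Lemma card_board : #|board b| = sumn b.
Proof.
rewrite sumnE (big_nth 0%N) big_mkord -sum1_card.
rewrite (eq_bigl (fun s : square b => (s.2 < nth 0 b s.1)%N)); last exact: mem_board_row.
rewrite -(pair_big_dep xpredT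
  (fun (i : 'I_(size b)) (j : 'I_(part b 1)) => (j < nth 0 b i)%N) (fun _ _ => 1%N)) /=.
apply: eq_bigr => i _; rewrite (big_ord_narrow (nth_part_le i)).
by rewrite sum1_card card_ord.
Qed.

Lemma rook_numberE k :
  rook_number b k = #|[set P in draws (board b) k | edges (rook_edge row col) P == set0]|.
Proof.
apply: eq_card => P; rewrite !inE -andbA edgesU setU_eq0; congr [&& _, _ & _].
rewrite -!distinct_linesE //; first by move=> [i j] [i' j'] [-> ->].
by move=> [i j] [i' j'] [-> ->].
Qed.

Lemma file_numberE k :
  file_number b k = #|[set P in draws (board b) k | edges (line_edge col row) P == set0]|.
Proof.
apply: eq_card => P; rewrite !inE -andbA; congr [&& _, _ & _].
by rewrite -distinct_linesE // => -[i j] [i' j'] [-> ->].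
Qed.

Lemma card_row_edges : #|edges (line_edge row col) (board b)| = pair_count b.
Proof.
apply: (@card_line_edges _ _ _ _ _ (fun i j => (i, j))) => //; first by case.
- exact: mem_board_row.
- exact: nth_part_le.
Qed.

Lemma card_col_edges : #|edges (line_edge col row) (board b)| = pair_count (conj_part b).
Proof.
apply: (@card_line_edges _ _ _ _ _ (fun j i => (i, j))) => //; first by case.
- exact: mem_board_col.
- exact: nth_conj_part_le.
- by rewrite size_map size_iota.
Qed.

Variable (R : realType) (N k : nat).
Hypotheses (k2 : (2 <= k)%N) (N2 : (2 <= N)%N).
Variable e : rel (square b).
Hypothesis e_rook : forall s t, e s t -> rook_edge row col s t.

Lemma sum_edge_nbrs_rows :
  (k%:R - 2) / (N%:R - 2) *
    \sum_(st in edges (line_edge row col) (board b)) #|edge_nbrs e (board b) st|%:R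
  <= s2 R N k b + s3 R N k b (conj_part b).
Proof.
apply: (@sum_edge_nbrs_line _ _ _ _ _ _ (fun i j => (i, j))) => //; first by case.
- exact: mem_board_row.
- exact: mem_board_col.
- exact: nth_part_le.
- exact: nth_conj_part_le.
Qed.

(** The relation [e] is left general because rooks take [rook_edge] and files only the attacks
    within columns. *)
Lemma sum_edge_nbrs_cols :
  (k%:R - 2) / (N%:R - 2) *
    \sum_(st in edges (line_edge col row) (board b)) #|edge_nbrs e (board b) st|%:R
  <= s2 R N k (conj_part b) + s3 R N k (conj_part b) b.
Proof.
apply: (@sum_edge_nbrs_line _ _ _ _ _ _ (fun j i => (i, j))) => //; first by case.
- exact: mem_board_col.
- exact: mem_board_row.
- exact: nth_conj_part_le.
- exact: nth_part_le.
- by move=> s t /e_rook; rewrite orbC.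
- by rewrite size_map size_iota.
Qed.

End Board.

Theorem theorem7 (R : realType) (b : seq nat) (k : nat)
  (hb : is_partition b) (hN : (3 <= sumn b)%N) (hk : (2 <= k <= sumn b)%N) :
  let b' := conj_part b in
  let N := sumn b in
  let L := pair_count b in
  let L' := pair_count b' in
  let l : R := lam R N k b in
  let l' : R := lam R N k b' in
  let d3 : R :=
    s0 R N b + s0 R N b' + s1 R N k b + s1 R N k b'
    + (s2 R N k b + s2 R N k b' + s3 R N k b b' + s3 R N k b' b)
      / (L%:R + L'%:R)
    + s4 R N k in
  let Rnk : R := Num.min d3 (Num.min ((l + l') * d3) 1) in
  let d4 : R :=
    s0 R N b' + s1 R N k b'
    + (s2 R N k b' + s3 R N k b' b) / L'%:R + s4 R N k in
  let Fnk : R := Num.min d4 (Num.min (l' * d4) 1) in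
  ('C(N, k)%:R * expR (- (l + l')) * (1 - expR (l + l') * Rnk)
     <= (rook_number b k)%:R
     <= 'C(N, k)%:R * expR (- (l + l')) * (1 + expR (l + l') * Rnk))
  /\
  ((0 < L')%N ->
   'C(N, k)%:R * expR (- l') * (1 - expR l' * Fnk)
     <= (file_number b k)%:R
     <= 'C(N, k)%:R * expR (- l') * (1 + expR l' * Fnk)).
Proof.
move=> b' N L L' l l' d3 Rnk d4 Fnk; have /andP[k2 kN] := hk.
have N2 : (2 <= N)%N by exact: ltnW.
split.
  apply: (@poisson_bound_of_degrees R (square b)
    (rook_edge (fun s => s.1) (fun s => s.2)) (board b) N (L + L') k (rook_number b k)
    (s2 R N k b + s2 R N k b' + s3 R N k b b' + s3 R N k b' b)) => //.
  - exact: rook_edge_asym.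
  - exact: card_board.
  - by rewrite card_rook_edges (card_row_edges hb) (card_col_edges hb).
  - by rewrite -rook_numberE.
  - by rewrite /l /l' /lam -mulrDl -mulrDr natrD.
  - by rewrite /d3 /s0 /s1 natrD mulrDr !mulrDl; ring.
  rewrite sum_rook_edges mulrDr; apply: le_trans.
    by apply: lerD; [apply: sum_edge_nbrs_rows|apply: sum_edge_nbrs_cols].
  by rewrite addrACA !addrA.
(* Files forbid only attacks within a column, so the graph keeps the column edges alone and [X] the
   primed sums. *)
move=> _; apply: (@poisson_bound_of_degrees R (square b)
  (line_edge (fun s => s.2) (fun s => s.1)) (board b) N L' k (file_number b k)
  (s2 R N k b' + s3 R N k b' b)) => //.
- exact: line_edge_asym.
- exact: card_board.
- exact: card_col_edges.
- by rewrite -file_numberE.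
- by apply: sum_edge_nbrs_cols => // s t; rewrite /rook_edge => ->; rewrite orbT.
Qed.
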